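(* Let $\Lambda=\{\Lambda_n^Q\}_{n\ge1}$ be an arbitrary sequence of quantum channels (CPTP maps) $\Lambda_n^Q:\mathcal{B}(\mathcal{K}_Q^{(n)})\to\mathcal{B}(\mathcal{H}_Q^{(n)})$ between finite-dimensional Hilbert spaces. Then its classical capacity is \[ C(\Lambda)=\sup_{\rho^{AQ}\in\mathcal{S}}\underline{S}(A:\Lambda Q), \] where $\mathcal{S}$ is the set of sequences $\rho^{AQ}=\{\rho_n^{AQ}\}$ of separable states on $\mathcal{H}_A^{(n)}\otimes\mathcal{K}_Q^{(n)}$ (over all finite-dimensional auxiliary spaces $\mathcal{H}_A^{(n)}$), and $\underline{S}(A:\Lambda Q)$ is the inf-spectral mutual information rate of the sequence $\rho_n^{A\Lambda Q}:=(\mathrm{id}_A\otimes\Lambda_n^Q)(\rho_n^{AQ})$.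
   Context: Logarithms are natural. For self-adjoint $A=\sum_i\lambda_i|i\rangle\langle i|$, $\{A\ge0\}:=\sum_{\lambda_i\ge0}|i\rangle\langle i|$ and $\{A\ge B\}:=\{A-B\ge0\}$. For a sequence of bipartite states $\rho^{XY}=\{\rho^{XY}_n\}$ with marginals $\rho^X_n,\rho^Y_n$, the inf-spectral mutual information rate is \[ \underline{S}(X:Y)=\sup\Big\{\gamma:\ \liminf_{n\to\infty}\mathrm{Tr}\big[\{\Pi_n(\gamma)\ge0\}\Pi_n(\gamma)\big]=1\Big\},\quad \Pi_n(\gamma)=\rho_n^{XY}-e^{n\gamma}\rho_n^X\otimes\rho_n^Y. \] A code $\mathcal{C}^{(n)}$ of size $M_n$ for $\Lambda_n^Q$ consists of states $\rho_n^i$ on $\mathcal{K}_Q^{(n)}$ and positive operators $E_n^i$ on $\mathcal{H}_Q^{(n)}$, $i=1,\dots,M_n$, with $\sum_iE_n^i\le I$; its average error probability is $P_e(\mathcal{C}^{(n)})=\frac1{M_n}\sum_{i=1}^{M_n}(1-\mathrm{Tr}(\Lambda_n^Q(\rho_n^i)E_n^i))$. A rate $R$ is achievable if there is a sequence of codes with $M_n\ge e^{nR}$ for all sufficiently large $n$ and $P_e(\mathcal{C}^{(n)})\to0$. The classical capacity $C(\Lambda)$ is the supremum of achievable rates. *)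

(* Defs.v *)
From mathcomp Require Import all_boot all_order all_algebra.
From mathcomp Require Import all_classical all_reals all_analysis.
From mathcomp Require Import complex mxtens.
Set Implicit Arguments.
Unset Strict Implicit.
Unset Printing Implicit Defensive.
Import Order.TTheory GRing.Theory Num.Theory.
Import numFieldTopology.Exports numFieldNormedType.Exports.
Local Open Scope ring_scope.
Local Open Scope classical_set_scope.

Section QuantumDefs.
Variable R : realType.
Local Notation C := (R[i]).

Definition toC (x : R) : C := Complex x 0.

Definition adjmx m n (A : 'M[C]_(m, n)) : 'M[C]_(n, m) := (map_mx Num.conj A)^T.

Definition psd n (A : 'M[C]_n) : Prop :=
  adjmx A = A /\ forall v : 'rV[C]_n, 0 <= (v *m A *m adjmx v) 0 0.

Definition is_state n (rho : 'M[C]_n) : Prop := psd rho /\ \tr rho = 1.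

(** the spectral projection {A >= 0}: with A = U^-1 diag(lambda) U
    (U unitary, the spectral decomposition of mathcomp's spectral.v),
    {A >= 0} = U^-1 diag(1_{lambda_i >= 0}) U *)
Definition posproj n (A : 'M[C]_n) : 'M[C]_n :=
  invmx (spectralmx A) *m
  diag_mx (\row_i (if 0 <= spectral_diag A 0 i then 1 else 0)) *m spectralmx A.

Definition ptrY dX dY (rho : 'M[C]_(dX * dY)) : 'M[C]_dX :=
  \matrix_(i, j) \sum_(y < dY) rho (mxtens_index (i, y)) (mxtens_index (j, y)).
Definition ptrX dX dY (rho : 'M[C]_(dX * dY)) : 'M[C]_dY :=
  \matrix_(i, j) \sum_(x < dX) rho (mxtens_index (x, i)) (mxtens_index (x, j)).

Definition block_of a m (rho : 'M[C]_(a * m)) (i j : 'I_a) : 'M[C]_m :=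
  \matrix_(x, y) rho (mxtens_index (i, x)) (mxtens_index (j, y)).
Definition id_tens a m n (Phi : 'M[C]_m -> 'M[C]_n) (rho : 'M[C]_(a * m))
  : 'M[C]_(a * n) :=
  \sum_(i < a) \sum_(j < a) (delta_mx i j *t Phi (block_of rho i j)).

Definition is_linear_map m n (Phi : 'M[C]_m -> 'M[C]_n) : Prop :=
  forall (c : C) (X Y : 'M[C]_m), Phi (c *: X + Y) = c *: Phi X + Phi Y.
Definition completely_positive m n (Phi : 'M[C]_m -> 'M[C]_n) : Prop :=
  forall (k : nat) (X : 'M[C]_(k * m)), psd X -> psd (id_tens Phi X).
Definition trace_preserving m n (Phi : 'M[C]_m -> 'M[C]_n) : Prop :=
  forall X : 'M[C]_m, \tr (Phi X) = \tr X.
Definition is_channel m n (Phi : 'M[C]_m -> 'M[C]_n) : Prop :=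
  [/\ is_linear_map Phi, completely_positive Phi & trace_preserving Phi].

Definition separable a q (rho : 'M[C]_(a * q)) : Prop :=
  exists (N : nat) (p : 'I_N -> R) (sig : 'I_N -> 'M[C]_a) (tau : 'I_N -> 'M[C]_q),
    [/\ forall k, 0 <= p k, \sum_k p k = 1,
        forall k, is_state (sig k), forall k, is_state (tau k) &
        rho = \sum_k toC (p k) *: (sig k *t tau k)].

Definition Pi_spec (dX dY : nat -> nat) (rho : forall n, 'M[C]_(dX n * dY n))
  (n : nat) (g : R) : 'M[C]_(dX n * dY n) :=
  rho n - toC (expR (n%:R * g)) *: (ptrY (rho n) *t ptrX (rho n)).

Definition inf_spec_MI (dX dY : nat -> nat) (rho : forall n, 'M[C]_(dX n * dY n))
  : \bar R :=
  ereal_sup [set (g%:E)%E | g in [set g : R |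
     limn_einf (fun n => (@complex.Re R (\tr (posproj (Pi_spec rho n g) *m Pi_spec rho n g)))%:E)
     = 1%:E]].

Definition is_code m n (M : nat) (rhos : 'I_M -> 'M[C]_m) (Es : 'I_M -> 'M[C]_n)
  : Prop :=
  [/\ (0 < M)%N, forall i, is_state (rhos i), forall i, psd (Es i)
    & psd (1%:M - \sum_i Es i)].

Definition err_prob m n (Phi : 'M[C]_m -> 'M[C]_n) (M : nat)
  (rhos : 'I_M -> 'M[C]_m) (Es : 'I_M -> 'M[C]_n) : R :=
  (M%:R)^-1 * \sum_i (1 - @complex.Re R (\tr (Phi (rhos i) *m Es i))).

Definition achievable (dK dH : nat -> nat)
  (Lam : forall n, 'M[C]_(dK n) -> 'M[C]_(dH n)) (r : R) : Prop :=
  exists (M : nat -> nat) (rhos : forall n, 'I_(M n) -> 'M[C]_(dK n))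
         (Es : forall n, 'I_(M n) -> 'M[C]_(dH n)),
    [/\ forall n, is_code (rhos n) (Es n),
        exists N, forall n, (N <= n)%N -> expR (n%:R * r) <= (M n)%:R
      & (fun n => err_prob (Lam n) (rhos n) (Es n)) @ \oo --> (0 : R)].

Definition capacity (dK dH : nat -> nat)
  (Lam : forall n, 'M[C]_(dK n) -> 'M[C]_(dH n)) : \bar R :=
  ereal_sup [set (r%:E)%E | r in achievable Lam].

End QuantumDefs.

(* Main.v *)
Require Import Defs.
From mathcomp Require Import all_boot all_order all_algebra.
From mathcomp Require Import all_classical all_reals all_analysis.
From mathcomp Require Import complex mxtens.
From mathcomp Require Import ring lra.
Set Implicit Arguments.
Unset Strict Implicit.
Unset Printing Implicit Defensive.
Import Order.TTheory GRing.Theory Num.Theory.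
Import numFieldTopology.Exports numFieldNormedType.Exports.
Local Open Scope ring_scope.
Local Open Scope classical_set_scope.

(** Put [c = exp (n g)], and let [t] be the trace of the positive part of
    [rho_AQ - c rho_A (x) rho_Q] for the output [rho_AQ] of the channel.

    Direct part: write the separable input as a mixture of [sig_k (x) tau_k] with
    weights [p_k].  Compressing the spectral projection by [sig_k] gives tests
    [T_k] with [t = al - c be], where [al] is the average of [tr (om_k T_k)],
    [om_k] the channel output of [tau_k], and [be] the average of
    [tr (om_k T_l)] over independent [k, l].  Since [al <= 1] and [be >= 0], both
    [1 - al] and [c be] are at most [1 - t].  Random coding with the
    square-root measurement and the Hayashi-Nagaoka inequality yields [M]
    codewords with error at most [2 (1 - al) + 4 (M - 1) be], which is at most
    [6 (1 - t)] for [M = floor c + 1].  So every [g] with [t -> 1] is itself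
    an achievable rate.

    Converse: a code is turned into the classical-quantum state
    [1/M sum_i |i><i| (x) rho_i]; the test [sum_i |i><i| (x) E_i] shows
    [t >= 1 - P_e - c / M]. *)

(** * Adjoints and positive semidefinite matrices *)

Section PsdCalculus.
Variable R : realType.
Local Notation C := (R[i]).
Local Open Scope sesquilinear_scope.

Lemma adjmxE m n (A : 'M[C]_(m, n)) : adjmx A = A ^t*.
Proof. by rewrite /adjmx map_trmx. Qed.

Lemma adjmxK m n : cancel (@adjmx R m n) (@adjmx R n m).
Proof. by move=> A; rewrite !adjmxE trmxCK. Qed.

Lemma adjmxM m n p (A : 'M[C]_(m, n)) (B : 'M[C]_(n, p)) :
  adjmx (A *m B) = adjmx B *m adjmx A.
Proof. by rewrite /adjmx map_mxM trmx_mul. Qed.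

Lemma adjmxD m n (A B : 'M[C]_(m, n)) : adjmx (A + B) = adjmx A + adjmx B.
Proof. by rewrite /adjmx map_mxD raddfD. Qed.

Lemma adjmxN m n (A : 'M[C]_(m, n)) : adjmx (- A) = - adjmx A.
Proof. by rewrite /adjmx map_mxN raddfN. Qed.

Lemma adjmxZ m n c (A : 'M[C]_(m, n)) : adjmx (c *: A) = c^* *: adjmx A.
Proof. by apply/matrixP => i j; rewrite !mxE rmorphM. Qed.

Lemma adjmx0 m n : adjmx (0 : 'M[C]_(m, n)) = 0.
Proof. by rewrite /adjmx map_mx0 trmx0. Qed.

Lemma adjmx1 n : adjmx (1%:M : 'M[C]_n) = 1%:M.
Proof. by rewrite /adjmx map_mx1 trmx1. Qed.

Lemma adjmx_tens m n p q (A : 'M[C]_(m, n)) (B : 'M[C]_(p, q)) :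
  adjmx (A *t B) = adjmx A *t adjmx B.
Proof. by rewrite /adjmx map_mxT trmx_tens. Qed.

Lemma adjmx_diag n (d : 'rV[C]_n) :
  adjmx (diag_mx d) = diag_mx (map_mx Num.conj d).
Proof. by rewrite /adjmx map_diag_mx tr_diag_mx. Qed.

Lemma adjmx_diag_real n (d : 'rV[C]_n) : (forall i, d 0 i \is Num.real) ->
  adjmx (diag_mx d) = diag_mx d.
Proof.
move=> dR; rewrite adjmx_diag; congr diag_mx.
by apply/rowP => i; rewrite mxE (CrealP (dR i)).
Qed.

(** The spectral decomposition with [adjmx] in place of the inverse. The rows of [U] are the
    eigenvectors, hence [U] on the right. *)
Lemma hermitian_spectral n (A : 'M[C]_n) : adjmx A = A ->
  let U := spectralmx A in let d := spectral_diag A in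
  [/\ A = adjmx U *m diag_mx d *m U, U *m adjmx U = 1%:M,
      adjmx U *m U = 1%:M & forall i, d 0 i \is Num.real].
Proof.
move=> hA /=.
have hs : A \is hermsymmx.
  apply/is_hermitianmxP; rewrite expr0 scale1r -{1}hA.
  by rewrite adjmxE.
have Uu := spectral_unitarymx A.
have UV : spectralmx A *m adjmx (spectralmx A) = 1%:M.
  by rewrite adjmxE; apply/unitarymxP.
split=> //.
- rewrite adjmxE -invmx_unitary //; apply/orthomx_spectralP.
  exact: hermitian_normalmx.
- exact: mulmx1C.
- move=> i; have /mxOverP := hermitian_spectral_diag_real hs.
  exact.
Qed.

Lemma adjmx_coef m n (A : 'M[C]_(m, n)) i j : adjmx A i j = (A j i)^*.
Proof. by rewrite !mxE. Qed.

Lemma psd_herm n (A : 'M[C]_n) : psd A -> adjmx A = A.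
Proof. by case. Qed.

Lemma psd0 n : psd (0 : 'M[C]_n).
Proof. by split=> [|v]; rewrite ?adjmx0 // mulmx0 mul0mx mxE. Qed.

Lemma psdD n (A B : 'M[C]_n) : psd A -> psd B -> psd (A + B).
Proof.
move=> [hA pA] [hB pB]; split=> [|v]; first by rewrite adjmxD hA hB.
by rewrite mulmxDr mulmxDl mxE addr_ge0.
Qed.

Lemma psdZ n c (A : 'M[C]_n) : 0 <= c -> psd A -> psd (c *: A).
Proof.
move=> c0 [hA pA]; split=> [|v].
  by rewrite adjmxZ hA (CrealP (ger0_real c0)).
by rewrite -scalemxAr -scalemxAl mxE mulr_ge0.
Qed.

Lemma psd_sum n (I : Type) (r : seq I) (P : pred I) (F : I -> 'M[C]_n) :
  (forall i, P i -> psd (F i)) -> psd (\sum_(i <- r | P i) F i).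
Proof. by move=> pF; apply: big_ind => //; [exact: psd0|exact: psdD]. Qed.

Lemma psd_congr m n (A : 'M[C]_n) (B : 'M[C]_(n, m)) :
  psd A -> psd (adjmx B *m A *m B).
Proof.
move=> [hA pA]; split=> [|v]; first by rewrite !adjmxM adjmxK hA mulmxA.
by have := pA (v *m adjmx B); rewrite adjmxM adjmxK !mulmxA.
Qed.

Lemma mul_row_adj_ge0 n (v : 'rV[C]_n) : 0 <= (v *m adjmx v) 0 0.
Proof.
by rewrite mxE sumr_ge0 // => i _; rewrite !mxE mul_conjC_ge0.
Qed.

Lemma psd1 n : psd (1%:M : 'M[C]_n).
Proof.
by split=> [|v]; [exact: adjmx1|rewrite mulmx1 mul_row_adj_ge0].
Qed.

Lemma psd_gram m n (B : 'M[C]_(m, n)) : psd (adjmx B *m B).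
Proof. by have := psd_congr B (psd1 m); rewrite mulmx1. Qed.

Lemma psd_diag_ge0 n (A : 'M[C]_n) i : psd A -> 0 <= A i i.
Proof.
move=> [_ /(_ (delta_mx 0 i))]; rewrite -rowE.
rewrite mxE (bigD1 i) //= !mxE !eqxx conjC1 mulr1 big1 ?addr0 // => j ji.
by rewrite !mxE (negPf ji) andbF conjC0 mulr0.
Qed.

Lemma psd_trace_ge0 n (A : 'M[C]_n) : psd A -> 0 <= \tr A.
Proof. by move=> pA; apply: sumr_ge0 => i _; exact: psd_diag_ge0. Qed.

Lemma psd_diag_mx n (d : 'rV[C]_n) : (forall i, 0 <= d 0 i) -> psd (diag_mx d).
Proof.
move=> d0; split=> [|v]; first by rewrite adjmx_diag_real // => i; exact: ger0_real.
rewrite mul_mx_diag mxE sumr_ge0 // => i _.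
by rewrite !mxE mulrAC mulr_ge0 // mul_conjC_ge0.
Qed.

Lemma psd_spectral_ge0 n (A : 'M[C]_n) i : psd A -> 0 <= spectral_diag A 0 i.
Proof.
move=> pA; have [AE UV _ _] := hermitian_spectral pA.1.
have := psd_diag_ge0 i (psd_congr (adjmx (spectralmx A)) pA).
rewrite {2}AE adjmxK !mulmxA UV mul1mx -mulmxA UV mulmx1 mxE eqxx mulr1n.
by [].
Qed.

(** [B] is [U] scaled by the roots of the eigenvalues. Gram factors reduce positivity of tensor
    products and of traces of products to [psd_gram] and [psd_congr]. *)
Lemma psd_factor n (A : 'M[C]_n) : psd A -> exists B : 'M[C]_n, A = adjmx B *m B.
Proof.
move=> pA; have [AE _ _ _] := hermitian_spectral pA.1.
set d := spectral_diag A in AE; pose s : 'rV[C]_n := \row_i sqrtC (d 0 i).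
exists (diag_mx s *m spectralmx A).
have sE : diag_mx d = diag_mx s *m diag_mx s.
  rewrite mulmx_diag; congr diag_mx; apply/rowP => i.
  by rewrite !mxE -expr2 sqrtCK.
rewrite adjmxM adjmx_diag_real ?mulmxA => [|i]; last first.
  by rewrite mxE ger0_real // sqrtC_ge0 psd_spectral_ge0.
by rewrite [LHS]AE sE !mulmxA.
Qed.

Lemma psd_trmul_ge0 n (A B : 'M[C]_n) : psd A -> psd B -> 0 <= \tr (A *m B).
Proof.
move=> /psd_factor[D ->] pB.
rewrite -mulmxA mxtrace_mulC; apply: psd_trace_ge0.
by have := psd_congr (adjmx D) pB; rewrite adjmxK.
Qed.

Lemma psd_tens m n (A : 'M[C]_m) (B : 'M[C]_n) : psd A -> psd B -> psd (A *t B).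
Proof.
move=> /psd_factor[D ->] /psd_factor[E ->].
by rewrite -tensmx_mul -adjmx_tens; exact: psd_gram.
Qed.

(** Operator monotonicity of the square root. Let [v] be a unit eigenvector of [Y - S] with
    eigenvalue [d < 0], and let [q], [r] be the values of the forms [Y], [S] at [v]. The hypothesis
    gives [d (q + r) >= 0], so [q = r = 0], against [q - r = d]. *)
Lemma psd_sqr_le n (Y S : 'M[C]_n) :
  psd Y -> psd S -> psd (Y *m Y - S *m S) -> psd (Y - S).
Proof.
move=> pY pS pD; pose D := Y - S.
have hD : adjmx D = D by rewrite /D adjmxD adjmxN pY.1 pS.1.
have [DE UV VU dR] := hermitian_spectral hD.
rewrite -/D DE; apply: psd_congr; apply: psd_diag_mx => i.
have [//|dn] := real_leP (@real0 _) (dR i).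
set d := spectral_diag D in DE dR dn *; set U := spectralmx D in DE UV VU *.
pose v := row i U.
have vD : v *m D = d 0 i *: v.
  rewrite {1}DE /v -row_mul !mulmxA UV mul1mx; apply/rowP => j.
  rewrite !mxE (bigD1 i) //= !mxE eqxx mulr1n big1 ?addr0 // => k ki.
  by rewrite !mxE eq_sym (negPf ki) mulr0n mul0r.
have Dv : D *m adjmx v = d 0 i *: adjmx v.
  by rewrite -{1}hD -adjmxM vD adjmxZ (CrealP (dR i)).
have vv : (v *m adjmx v) 0 0 = 1.
  have : (U *m adjmx U) i i = 1 by rewrite UV mxE eqxx.
  by rewrite !mxE => <-; apply: eq_bigr => j _; rewrite !mxE.
(* A difference of squares without commutation, arranged so that [D] meets [v] in one term and
   [adjmx v] in the other. *)
have YS : Y *m Y - S *m S = D *m Y + S *m D.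
  by rewrite /D mulmxBl mulmxBr addrA subrK.
have q0 := pY.2 v; have r0 := pS.2 v.
have qr0 : 0 <= d 0 i * ((v *m Y *m adjmx v) 0 0 + (v *m S *m adjmx v) 0 0).
  have := pD.2 v; rewrite YS mulmxDr mulmxDl mulmxA vD mulmxA -(mulmxA _ D) Dv.
  by rewrite -!scalemxAl -!scalemxAr -scalerDr mxE [X in _ * X]mxE.
have qr : (v *m Y *m adjmx v) 0 0 - (v *m S *m adjmx v) 0 0 = d 0 i.
  have : (v *m D *m adjmx v) 0 0 = d 0 i by rewrite vD -scalemxAl mxE vv mulr1.
  by rewrite /D mulmxBr mulmxBl mxE [X in _ + X]mxE.
move: qr qr0 q0 r0; set q := (v *m Y *m _) 0 0; set r := (v *m S *m _) 0 0.
rewrite nmulr_rge0 // => qr qr0 q0 r0.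
have q00 : q = 0.
  by apply/eqP; rewrite eq_le q0 andbT; apply: le_trans qr0; rewrite lerDl.
by move: dn qr0; rewrite -qr q00 sub0r add0r oppr_lt0 => /lt_geF ->.
Qed.

End PsdCalculus.

(* Otherwise [done] unfolds these when comparing matrix expressions and diverges
   in practice. *)
#[local] Opaque psd adjmx posproj spectralmx spectral_diag.

(** The algebra behind the Hayashi-Nagaoka inequality. Here [W] is a sum of tests, [S] one of them,
    and [X] plays the inverse square root of [W], so that [X *m W] is its root. Every summand on the
    right is then positive. *)
Lemma square_root_measurement_identity (K : comNzRingType) n (X W S : 'M[K]_n) :
  W *m X = X *m W ->
  2 *: (1%:M - S) + 4 *: (W - S) - (1%:M - X *m S *m X) =
  (1%:M + (1%:M - X)) *m (W - S) *m (1%:M + (1%:M - X)) +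
  2 *: ((1%:M - X) *m S *m (1%:M - X)) +
  (1%:M - X *m W *m X + 4 *: (X *m W - S)).
Proof.
move=> XW.
have e1 (Z : 'M[K]_n) : (1%:M - X) *m Z *m (1%:M - X) =
    Z - X *m Z - Z *m X + X *m Z *m X.
  rewrite mulmxBl mul1mx mulmxBr mulmx1 mulmxBl opprB addrA.
  by rewrite addrAC.
have e2 (P Z : 'M[K]_n) : (1%:M + P) *m Z *m (1%:M + P) =
    Z + P *m Z + Z *m P + P *m Z *m P.
  by rewrite mulmxDl mul1mx mulmxDr mulmx1 mulmxDl addrA.
rewrite e2 !e1 !(mulmxBr, mulmxBl) !(mul1mx, mulmx1) XW.
(* With the products as atoms, the identity is linear in the matrix entries. *)
move: (X *m S) (S *m X) (X *m S *m X) (X *m W *m X) (X *m W) 1%:M => A B D E F I.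
by apply/matrixP => i j; rewrite !mxE; ring.
Qed.

(** * Functional calculus, the Hayashi-Nagaoka inequality and spectral projections *)

Section SpectralTools.
Variable R : realType.
Local Notation C := (R[i]).

(** For unitary [U], the matrix with eigenvalues [a] on the rows of [U]; with [U] fixed, products
    act on eigenvalues. *)
Definition udiag n (U : 'M[C]_n) (a : 'rV[C]_n) := adjmx U *m diag_mx a *m U.

Lemma mulmx_udiag n (U : 'M[C]_n) (a b : 'rV[C]_n) : U *m adjmx U = 1%:M ->
  udiag U a *m udiag U b = udiag U (\row_i (a 0 i * b 0 i)).
Proof.
move=> UV; rewrite /udiag -!mulmxA (mulmxA U) UV mul1mx (mulmxA (diag_mx a)).
by rewrite mulmx_diag.
Qed.

Lemma adjmx_udiag n (U : 'M[C]_n) (a : 'rV[C]_n) :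
  (forall i, a 0 i \is Num.real) -> adjmx (udiag U a) = udiag U a.
Proof. by move=> aR; rewrite /udiag !adjmxM adjmxK adjmx_diag_real // mulmxA. Qed.

Lemma psd_udiag n (U : 'M[C]_n) (a : 'rV[C]_n) : (forall i, 0 <= a 0 i) ->
  psd (udiag U a).
Proof. by move=> a0; apply: psd_congr; exact: psd_diag_mx. Qed.

Lemma psd_1_sub_udiag n (U : 'M[C]_n) (a : 'rV[C]_n) :
  adjmx U *m U = 1%:M -> (forall i, a 0 i <= 1) -> psd (1%:M - udiag U a).
Proof.
move=> VU a1; have -> : 1%:M - udiag U a = udiag U (\row_i (1 - a 0 i)).
  have -> : (\row_i (1 - a 0 i)) = const_mx 1 - a by apply/rowP => i; rewrite !mxE.
  by rewrite /udiag raddfB /= diag_const_mx mulmxBr mulmx1 mulmxBl VU.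
by apply: psd_udiag => i; rewrite mxE subr_ge0.
Qed.

Lemma psd_spectral n (W : 'M[C]_n) : psd W -> exists (U : 'M[C]_n) (d : 'rV[C]_n),
  [/\ W = udiag U d, U *m adjmx U = 1%:M, adjmx U *m U = 1%:M &
      forall i, 0 <= d 0 i].
Proof.
move=> pW; have [WE UV VU _] := hermitian_spectral (psd_herm pW).
exists (spectralmx W), (spectral_diag W); split=> [||//|i]; [exact: WE|exact: UV|].
exact: psd_spectral_ge0.
Qed.

(** [Y] is the square root of [W] and [X] the pseudoinverse of [Y], so [X *m W *m X] is the
    projection onto the support of [W]. *)
Lemma psd_sqrt_pinv n (W : 'M[C]_n) : psd W -> exists X Y : 'M[C]_n,
  [/\ adjmx X = X, psd Y, Y *m Y = W, X *m W = Y /\ W *m X = Y &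
      psd (1%:M - X *m W *m X)].
Proof.
move=> /psd_spectral[U [d [-> UV VU d0]]].
pose s : 'rV[C]_n := \row_i sqrtC (d 0 i).
have s0 i : 0 <= s 0 i by rewrite mxE sqrtC_ge0.
have ss : \row_i (s 0 i * s 0 i) = d by apply/rowP => i; rewrite !mxE -expr2 sqrtCK.
(* The convention [0^-1 = 0] makes this the pseudoinverse on the kernel. *)
pose x : 'rV[C]_n := \row_i (s 0 i)^-1.
have xd : \row_i (x 0 i * d 0 i) = s.
  apply/rowP => i; rewrite !mxE -[X in _ * X]sqrtCK expr2.
  by have [->|sn] := eqVneq (sqrtC (d 0 i)) 0; rewrite ?mulr0 // mulKf.
have dx : \row_i (d 0 i * x 0 i) = s.
  by rewrite -xd; apply/rowP => i; rewrite !mxE mulrC.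
exists (udiag U x), (udiag U s).
rewrite !(mulmx_udiag _ _ UV) ss xd dx; split.
- by apply: adjmx_udiag => i; rewrite mxE rpredV ger0_real.
- exact: psd_udiag.
- reflexivity.
- by split; reflexivity.
- apply: psd_1_sub_udiag => // i.
  rewrite !mxE; have [->|sn] := eqVneq (sqrtC (d 0 i)) 0; first by rewrite mul0r ler01.
  by rewrite divff.
Qed.

(** [S - S^2] equals [S (1 - S) S + (1 - S) S (1 - S)], a sum of two congruences of positive
    matrices. *)
Lemma psd_sub_sqr n (S : 'M[C]_n) : psd S -> psd (1%:M - S) -> psd (S - S *m S).
Proof.
move=> pS pS'; have -> : S - S *m S =
    adjmx S *m (1%:M - S) *m S + adjmx (1%:M - S) *m S *m (1%:M - S).
  rewrite (psd_herm pS) (psd_herm pS') !mulmxBl !mulmxBr !mul1mx !mulmx1 mulmxBl.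
  by apply/matrixP => i j; rewrite !mxE; ring.
by apply: psdD; exact: psd_congr.
Qed.

(** [X] is fixed before [S], so one [X] serves every test of a decoder. The identity above reduces
    the claim to [S <= Y] for the root [Y] of [W]. *)
Lemma hayashi_nagaoka n (W : 'M[C]_n) : psd W -> exists X : 'M[C]_n,
  [/\ adjmx X = X, psd (1%:M - X *m W *m X) &
   forall S, psd S -> psd (1%:M - S) -> psd (W - S) ->
     psd (2 *: (1%:M - S) + 4 *: (W - S) - (1%:M - X *m S *m X))].
Proof.
move=> pW; have [X [Y [hX pY YY [XW WX] pXWX]]] := psd_sqrt_pinv pW.
exists X; split=> [||S pS pS1 pT]; [exact: hX|exact: pXWX|].
have pYS : psd (Y - S).
  (* [Y^2 - S^2] is split as [(W - S) + (S - S^2)]. *)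
  apply: (psd_sqr_le pY pS); rewrite YY -(subrK S W) -addrA.
  exact: psdD pT (psd_sub_sqr pS pS1).
have h2 : adjmx (1%:M + (1%:M - X)) = 1%:M + (1%:M - X).
  by rewrite !adjmxD adjmxN adjmx1 hX.
have h1 : adjmx (1%:M - X) = 1%:M - X by rewrite adjmxD adjmxN adjmx1 hX.
have := psd_congr (1%:M + (1%:M - X)) pT; rewrite h2 => p1.
have := psd_congr (1%:M - X) pS; rewrite h1 => p2.
have p0 (k : nat) : 0 <= k%:R :> C by exact: ler0n.
rewrite (square_root_measurement_identity S (etrans WX (esym XW))) XW.
rewrite XW in pXWX.
exact: (psdD (psdD p1 (psdZ (p0 2%N) p2)) (psdD pXWX (psdZ (p0 4%N) pYS))).
Qed.

Lemma posprojE n (A : 'M[C]_n) : posproj A =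
  udiag (spectralmx A) (\row_i (if 0 <= spectral_diag A 0 i then 1 else 0)).
Proof. by rewrite /udiag adjmxE -invmx_unitary ?spectral_unitarymx. Qed.

Lemma psd_posproj n (A : 'M[C]_n) : psd (posproj A).
Proof.
by rewrite posprojE; apply: psd_udiag => i; rewrite mxE; case: ifP; rewrite ?ler01.
Qed.

Lemma psd_1_sub_posproj n (A : 'M[C]_n) : adjmx A = A -> psd (1%:M - posproj A).
Proof.
move=> hA; have [_ _ VU _] := hermitian_spectral hA.
rewrite posprojE; apply: psd_1_sub_udiag VU _ => i.
by rewrite mxE; case: ifP; rewrite ?ler01.
Qed.

(** In an eigenbasis of [A] the trace is the sum of [t_i d_i] with [0 <= t_i <= 1], largest when
    [t_i] indicates [d_i >= 0]. *)
Lemma posproj_max n (A T : 'M[C]_n) : adjmx A = A -> psd T -> psd (1%:M - T) ->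
  \tr (T *m A) <= \tr (posproj A *m A).
Proof.
move=> hA pT pT1; have := hermitian_spectral hA; rewrite posprojE /=.
move: (spectralmx A) (spectral_diag A) => U d [AE UV VU dR].
have pT' := psd_congr (adjmx U) pT; have pT1' := psd_congr (adjmx U) pT1.
rewrite adjmxK in pT' pT1'.
have -> : \tr (T *m A) = \sum_i (U *m T *m adjmx U) i i * d 0 i.
  rewrite {1}AE !mulmxA mxtrace_mulC !mulmxA mul_mx_diag.
  by apply: eq_bigr => i _; rewrite mxE.
rewrite [in leRHS]AE mulmx_udiag // mxtrace_mulC mulmxA UV mul1mx.
rewrite mxtrace_diag; apply: ler_sum => i _.
rewrite [leRHS]mxE [X in _ <= X * _]mxE.
have := psd_diag_ge0 i pT1'.
rewrite mulmxBr mulmx1 mulmxBl UV mxE [1%:M i i]mxE [X in _ + X]mxE eqxx mulr1n.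
rewrite subr_ge0.
move: (psd_diag_ge0 i pT'); move: ((U *m T *m adjmx U) i i) => t t0 t1.
case: ifPn => di; first by rewrite ler_wpM2r.
by rewrite mul0r mulr_ge0_le0 // ltW // real_ltNge // ?dR // real0.
Qed.

End SpectralTools.

(** * Bilinearity and traces of Kronecker products *)

Section Tensor.
Variable K : comNzRingType.

Lemma big_mxtens (V : nmodType) m n (F : 'I_(m * n) -> V) :
  \sum_k F k = \sum_i \sum_j F (mxtens_index (i, j)).
Proof.
rewrite pair_big /= (reindex (@mxtens_index m n)) /=; last first.
  by exists (@mxtens_unindex m n) => k _; rewrite (mxtens_indexK, mxtens_unindexK).
by apply: eq_bigr => -[].
Qed.

Lemma tensmxP m n p q (A B : 'M[K]_(m * p, n * q)) :
  (forall i j k l, A (mxtens_index (i, j)) (mxtens_index (k, l)) =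
                   B (mxtens_index (i, j)) (mxtens_index (k, l))) -> A = B.
Proof.
move=> AB; apply/matrixP => i j.
rewrite -(mxtens_unindexK i) -(mxtens_unindexK j).
by case: (mxtens_unindex i) (mxtens_unindex j) => ? ? [].
Qed.

Lemma tensmxDr m n p q (A : 'M[K]_(m, n)) (B D : 'M[K]_(p, q)) :
  A *t (B + D) = A *t B + A *t D.
Proof. by apply/matrixP => i j; rewrite !mxE mulrDr. Qed.

Lemma tensmxDl m n p q (A D : 'M[K]_(m, n)) (B : 'M[K]_(p, q)) :
  (A + D) *t B = A *t B + D *t B.
Proof. by apply/matrixP => i j; rewrite !mxE mulrDl. Qed.

Lemma tensmxZr m n p q (A : 'M[K]_(m, n)) c (B : 'M[K]_(p, q)) :
  A *t (c *: B) = c *: (A *t B).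
Proof. by apply/matrixP => i j; rewrite !mxE mulrCA. Qed.

Lemma tensmxZl m n p q c (A : 'M[K]_(m, n)) (B : 'M[K]_(p, q)) :
  (c *: A) *t B = c *: (A *t B).
Proof. by apply/matrixP => i j; rewrite !mxE mulrA. Qed.

Lemma tensmxBr m n p q (A : 'M[K]_(m, n)) (B D : 'M[K]_(p, q)) :
  A *t (B - D) = A *t B - A *t D.
Proof. by rewrite tensmxDr -scaleN1r tensmxZr scaleN1r. Qed.

Lemma tensmx_sumr m n p q (A : 'M[K]_(m, n)) I (r : seq I) (F : I -> 'M[K]_(p, q)) :
  A *t (\sum_(k <- r) F k) = \sum_(k <- r) A *t F k.
Proof. by apply: (big_morph (tensmx A)); [exact: tensmxDr|exact: tensmx0]. Qed.

Lemma tensmx_suml m n p q I (r : seq I) (F : I -> 'M[K]_(m, n)) (A : 'M[K]_(p, q)) :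
  (\sum_(k <- r) F k) *t A = \sum_(k <- r) F k *t A.
Proof.
apply: (big_morph (fun X : 'M[K]_(m, n) => X *t A)) => [X Y|].
  exact: tensmxDl.
exact: tens0mx.
Qed.

Lemma tensmx1 m n : 1%:M *t 1%:M = 1%:M :> 'M[K]_(m * n).
Proof.
apply: tensmxP => i j k l; rewrite tensmxE !mxE -natrM mulnb.
by rewrite (can_eq (@mxtens_indexK m n)).
Qed.

Lemma mxtrace_tens m n (A : 'M[K]_m) (B : 'M[K]_n) : \tr (A *t B) = \tr A * \tr B.
Proof.
rewrite /mxtrace big_mxtens mulr_suml; apply: eq_bigr => i _.
by rewrite mulr_sumr; apply: eq_bigr => j _; rewrite tensmxE.
Qed.

End Tensor.

(** * Partial traces, compressed tests and channels acting on one factor *)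

Section Bipartite.
Variable R : realType.
Local Notation C := (R[i]).

(** The submatrix is a congruence by the 0/1 matrix that selects the columns [f j]; [f] may repeat
    indices. *)
Lemma psd_mxsub m n (f : 'I_m -> 'I_n) (A : 'M[C]_n) : psd A -> psd (mxsub f f A).
Proof.
move=> /(psd_congr (colsub f 1%:M)).
have -> : adjmx (colsub f 1%:M : 'M[C]_(n, m)) = rowsub f 1%:M.
  by apply/matrixP => i j; rewrite adjmx_coef !mxE eq_sym rmorph_nat.
rewrite -mulmxA mulmx_colsub mulmx1 mul_rowsub_mx mul1mx; congr psd.
by apply/matrixP => i j; rewrite !mxE.
Qed.

(** As a sum of diagonal blocks, the partial trace inherits positivity from [psd_mxsub]. *)
Lemma ptrX_mxsub m n (A : 'M[C]_(m * n)) :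
  let f x (i : 'I_n) := mxtens_index (x, i) in
  ptrX A = \sum_(x < m) mxsub (f x) (f x) A.
Proof.
by apply/matrixP => i j; rewrite mxE summxE; apply: eq_bigr => x _; rewrite mxE.
Qed.

Lemma psd_ptrX m n (A : 'M[C]_(m * n)) : psd A -> psd (ptrX A).
Proof. by move=> pA; rewrite ptrX_mxsub; apply: psd_sum => x _; exact: psd_mxsub. Qed.

Lemma ptrXD m n (A B : 'M[C]_(m * n)) : ptrX (A + B) = ptrX A + ptrX B.
Proof.
apply/matrixP => i j; rewrite [LHS]mxE [RHS]mxE [ptrX A i j]mxE [ptrX B i j]mxE.
by rewrite -big_split; apply: eq_bigr => x _; rewrite mxE.
Qed.

Lemma ptrXZ m n c (A : 'M[C]_(m * n)) : ptrX (c *: A) = c *: ptrX A.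
Proof.
apply/matrixP => i j; rewrite [LHS]mxE [RHS]mxE [ptrX A i j]mxE.
by rewrite mulr_sumr; apply: eq_bigr => x _; rewrite mxE.
Qed.

Lemma ptrXB m n (A B : 'M[C]_(m * n)) : ptrX (A - B) = ptrX A - ptrX B.
Proof. by rewrite ptrXD -scaleN1r ptrXZ scaleN1r. Qed.

Lemma ptrX0 m n : ptrX (0 : 'M[C]_(m * n)) = 0.
Proof. by rewrite -(scale0r 0) ptrXZ scale0r. Qed.

Lemma ptrX_sum m n I (r : seq I) (F : I -> 'M[C]_(m * n)) :
  ptrX (\sum_(k <- r) F k) = \sum_(k <- r) ptrX (F k).
Proof. by apply: (big_morph (@ptrX R m n)); [exact: ptrXD|exact: ptrX0]. Qed.

Lemma ptrX_tens m n (A : 'M[C]_m) (B : 'M[C]_n) : ptrX (A *t B) = \tr A *: B.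
Proof.
apply/matrixP => i j; rewrite [LHS]mxE [RHS]mxE mulr_suml.
by apply: eq_bigr => x _; rewrite tensmxE.
Qed.

Lemma ptrYD m n (A B : 'M[C]_(m * n)) : ptrY (A + B) = ptrY A + ptrY B.
Proof.
apply/matrixP => i j; rewrite [LHS]mxE [RHS]mxE [ptrY A i j]mxE [ptrY B i j]mxE.
by rewrite -big_split; apply: eq_bigr => x _; rewrite mxE.
Qed.

Lemma ptrYZ m n c (A : 'M[C]_(m * n)) : ptrY (c *: A) = c *: ptrY A.
Proof.
apply/matrixP => i j; rewrite [LHS]mxE [RHS]mxE [ptrY A i j]mxE.
by rewrite mulr_sumr; apply: eq_bigr => x _; rewrite mxE.
Qed.

Lemma ptrY0 m n : ptrY (0 : 'M[C]_(m * n)) = 0.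
Proof. by rewrite -(scale0r 0) ptrYZ scale0r. Qed.

Lemma ptrY_sum m n I (r : seq I) (F : I -> 'M[C]_(m * n)) :
  ptrY (\sum_(k <- r) F k) = \sum_(k <- r) ptrY (F k).
Proof. by apply: (big_morph (@ptrY R m n)); [exact: ptrYD|exact: ptrY0]. Qed.

Lemma ptrY_tens m n (A : 'M[C]_m) (B : 'M[C]_n) : ptrY (A *t B) = \tr B *: A.
Proof.
apply/matrixP => i j; rewrite [LHS]mxE [RHS]mxE mulrC mulr_sumr.
by apply: eq_bigr => x _; rewrite tensmxE.
Qed.

Lemma mxtrace_ptrX_mul m n (A : 'M[C]_(m * n)) (X : 'M[C]_n) :
  \tr (ptrX A *m X) = \tr (A *m (1%:M *t X)).
Proof.
have -> : \tr (A *m (1%:M *t X)) =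
    \sum_x \sum_i \sum_j A (mxtens_index (x, i)) (mxtens_index (x, j)) * X j i.
  rewrite /mxtrace big_mxtens; apply: eq_bigr => x _; apply: eq_bigr => i _.
  rewrite mxE big_mxtens (bigD1 x) //= [X in _ + X]big1 ?addr0 => [|y yx].
    by apply: eq_bigr => j _; rewrite tensmxE mxE eqxx mul1r.
  by rewrite big1 // => j _; rewrite tensmxE mxE (negPf yx) mul0r mulr0.
rewrite exchange_big; apply: eq_bigr => i _; rewrite exchange_big mxE.
by apply: eq_bigr => j _; rewrite mxE mulr_suml.
Qed.

(** With [sigma = adjmx B *m B], conjugate [T] by [B *t 1] and trace out the first factor. The same
    operation sends the identity to [\tr sigma] times the identity, so the bound by 1 survives. *)
Lemma compressed_test m n (T : 'M[C]_(m * n)) (sigma : 'M[C]_m) :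
  psd T -> psd (1%:M - T) -> is_state sigma -> exists T' : 'M[C]_n,
  [/\ psd T', psd (1%:M - T') & forall X, \tr (T' *m X) = \tr (T *m (sigma *t X))].
Proof.
move=> pT pT1 [/psd_factor[B sE] tr1].
pose V : 'M[C]_(m * n) := adjmx B *t 1%:M.
have VE : adjmx V = B *t 1%:M by rewrite adjmx_tens adjmxK adjmx1.
exists (ptrX (adjmx V *m T *m V)); split.
- by apply: psd_ptrX; exact: psd_congr.
- have -> : 1%:M = ptrX (adjmx V *m V).
    by rewrite VE tensmx_mul mulmx1 ptrX_tens mxtrace_mulC -sE tr1 scale1r.
  rewrite -ptrXB; apply: psd_ptrX.
  by have := psd_congr V pT1; rewrite mulmxBr mulmx1 mulmxBl.
- move=> X; rewrite mxtrace_ptrX_mul VE -!mulmxA mxtrace_mulC -!mulmxA.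
  by rewrite !tensmx_mul !mul1mx mulmx1 -sE.
Qed.

Lemma is_channel_state m n (Phi : 'M[C]_m -> 'M[C]_n) tau :
  is_channel Phi -> is_state tau -> is_state (Phi tau).
Proof.
move=> [lin cp tp] [ptau tr1]; split; last by rewrite tp.
(* Positivity is complete positivity with a one-dimensional ancilla, up to the reindexing of [1 * n]
   by [n]. *)
have := cp 1%N (1%:M *t tau) (psd_tens (psd1 R 1) ptau).
move=> /(psd_mxsub (fun i => mxtens_index (ord0, i))); congr psd.
apply/matrixP => i j; rewrite mxE /id_tens !big_ord1 tensmxE !mxE mul1r.
congr (Phi _ _ _); apply/matrixP => k l.
by rewrite mxE tensmxE mxE mul1r.
Qed.

Lemma is_linear_map_sum m n (Phi : 'M[C]_m -> 'M[C]_n) I (r : seq I)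
    (p : I -> C) (F : I -> 'M[C]_m) : is_linear_map Phi ->
  Phi (\sum_(k <- r) p k *: F k) = \sum_(k <- r) p k *: Phi (F k).
Proof.
move=> lin; elim: r => [|k r IH]; last by rewrite !big_cons lin IH.
by rewrite !big_nil; have := lin (-1) 0 0; rewrite scaleN1r oppr0 addr0 scaleN1r addNr.
Qed.

(** Block [(i, j)] of the input is the combination of the [tau k] with coefficients
    [p k * sig k i j]; applying [Phi] blockwise and reassembling gives back the ensemble form. *)
Lemma id_tens_sum a m n (Phi : 'M[C]_m -> 'M[C]_n) N (p : 'I_N -> C)
    (sig : 'I_N -> 'M[C]_a) (tau : 'I_N -> 'M[C]_m) : is_linear_map Phi ->
  id_tens Phi (\sum_k p k *: (sig k *t tau k)) = \sum_k p k *: (sig k *t Phi (tau k)).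
Proof.
move=> lin; rewrite /id_tens.
have blockE i j : block_of (\sum_k p k *: (sig k *t tau k)) i j =
    \sum_k (p k * sig k i j) *: tau k.
  apply/matrixP => x y; rewrite mxE !summxE; apply: eq_bigr => k _.
  by rewrite !mxE !mxtens_indexK mulrA.
under eq_bigr => i _ do under eq_bigr => j _ do
  rewrite blockE is_linear_map_sum // tensmx_sumr.
under eq_bigr => i _ do rewrite exchange_big.
rewrite exchange_big; apply: eq_bigr => k _.
rewrite [X in X *t _]matrix_sum_delta tensmx_suml scaler_sumr; apply: eq_bigr => i _.
rewrite tensmx_suml scaler_sumr; apply: eq_bigr => j _.
by rewrite tensmxZr tensmxZl scalerA.
Qed.

End Bipartite.

(** * Random codebooks with independent codewords *)

Section RandomChoice.
Variable R : realFieldType.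

(** If every [v f] exceeded [b], the terms [w f * (v f - b)] would be nonnegative with sum at most
    0. All weights would then vanish, against their sum 1. *)
Lemma exists_le_average (I : finType) (w v : I -> R) (b : R) :
  (forall f, 0 <= w f) -> \sum_f w f = 1 -> \sum_f w f * v f <= b ->
  exists f, v f <= b.
Proof.
move=> w0 w1 wv; apply: contrapT => /forallNP vb.
have {}vb f : b < v f by rewrite ltNge; apply/negP/vb.
have s0 : \sum_f w f * (v f - b) = 0.
  apply/eqP; rewrite eq_le sumr_ge0 ?andbT => [|f _]; last first.
    by rewrite mulr_ge0 // subr_ge0 ltW.
  under eq_bigr do rewrite mulrBr.
  by rewrite sumrB -mulr_suml w1 mul1r subr_le0.
have wf0 f : w f = 0.
  have ge0 i : true -> 0 <= w i * (v i - b) by rewrite mulr_ge0 // subr_ge0 ltW.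
  move/eqP: s0; rewrite psumr_eq0 // => /allP/(_ f (mem_index_enum _)).
  by rewrite mulf_eq0 subr_eq0 (gt_eqF (vb f)) orbF => /eqP.
by move/eqP: w1; rewrite big1 // eq_sym oner_eq0.
Qed.

Variables (N M : nat) (p : 'I_N -> R).
Hypotheses (p0 : forall k, 0 <= p k) (p1 : \sum_k p k = 1).

Definition codebook_weight (f : {ffun 'I_M -> 'I_N}) := \prod_i p (f i).

Lemma sum_codebook_weight : \sum_f codebook_weight f = 1.
Proof.
transitivity (\prod_(i < M) \sum_k p k); first by rewrite bigA_distr_bigA.
by rewrite big1.
Qed.

Lemma expectation_codeword i (u : 'I_N -> R) :
  \sum_f codebook_weight f * u (f i) = \sum_k p k * u k.
Proof.
(* Writing [u (f i)] as a product over all positions lets the sum over codebooks factor; each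
   position other than [i] contributes 1. *)
transitivity (\prod_(j < M) \sum_k p k * (if j == i then u k else 1)).
  rewrite bigA_distr_bigA; apply: eq_bigr => f _.
  rewrite big_split /=; congr (_ * _).
  by rewrite -big_mkcond big_pred1_eq.
rewrite (bigD1 i) //= [X in _ * X]big1 ?mulr1 => [|j ji].
  by apply: eq_bigr => k _; rewrite eqxx.
by rewrite -[RHS]p1; apply: eq_bigr => k _; rewrite (negPf ji) mulr1.
Qed.

Lemma expectation_codeword_mul i j (u v : 'I_N -> R) : i != j ->
  \sum_f codebook_weight f * (u (f i) * v (f j)) =
  (\sum_k p k * u k) * (\sum_k p k * v k).
Proof.
move=> ij; transitivity (\prod_(l < M) \sum_k
    p k * ((if l == i then u k else 1) * (if l == j then v k else 1))).
  rewrite bigA_distr_bigA; apply: eq_bigr => f _.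
  rewrite big_split /=; congr (_ * _).
  by rewrite big_split /= -!big_mkcond !big_pred1_eq.
rewrite (bigD1 i) //= (bigD1 j) 1?eq_sym //= [X in _ * (_ * X)]big1 ?mulr1.
  congr (_ * _); apply: eq_bigr => k _; rewrite eqxx.
    by rewrite eq_sym (negPf ij) mulr1.
  by rewrite eq_sym (negPf ij) mul1r.
move=> l /andP[li lj]; rewrite -[RHS]p1; apply: eq_bigr => k _.
by rewrite (negPf li) (negPf lj) !mulr1.
Qed.

(** Expanding [h] along the indicators of the second codeword reduces to products of functions of
    one codeword each. *)
Lemma expectation_codeword_pair i j (h : 'I_N -> 'I_N -> R) : i != j ->
  \sum_f codebook_weight f * h (f i) (f j) = \sum_k \sum_l p k * p l * h k l.
Proof.
move=> ij; transitivity (\sum_l \sum_f codebook_weight f *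
    (h (f i) l * (f j == l)%:R)).
  rewrite exchange_big; apply: eq_bigr => f _; rewrite -mulr_sumr; congr (_ * _).
  rewrite (bigD1 (f j)) //= eqxx mulr1 big1 ?addr0 // => l.
  by rewrite eq_sym => /negPf->; rewrite mulr0.
rewrite [RHS]exchange_big; apply: eq_bigr => l _.
rewrite (expectation_codeword_mul (h ^~ l) (fun k => (k == l)%:R)) // mulr_suml.
apply: eq_bigr => k _; rewrite (bigD1 l) //= eqxx mulr1 big1 ?addr0.
  by rewrite mulrAC.
by move=> l' /negPf->; rewrite mulr0.
Qed.

(** [g] stands for the cost of missing the sent codeword and [h] for confusion with another one.
    Each of the [M] positions has [M - 1] rivals. *)
Lemma exists_codebook (g : 'I_N -> R) (h : 'I_N -> 'I_N -> R) :
  exists f : 'I_M -> 'I_N,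
  \sum_i (g (f i) + \sum_(j | j != i) h (f i) (f j)) <=
  M%:R * (\sum_k p k * g k + (M%:R - 1) * \sum_k \sum_l p k * p l * h k l).
Proof.
have [|||f hf] := @exists_le_average _ codebook_weight (fun f : {ffun 'I_M -> 'I_N} =>
  \sum_i (g (f i) + \sum_(j | j != i) h (f i) (f j)))
  (M%:R * (\sum_k p k * g k + (M%:R - 1) * \sum_k \sum_l p k * p l * h k l)).
- by move=> f; apply: prodr_ge0.
- exact: sum_codebook_weight.
- under eq_bigr do rewrite mulr_sumr.
  rewrite exchange_big /=.
  rewrite le_eqVlt; apply/orP; left; apply/eqP.
  transitivity (\sum_(i < M) (\sum_k p k * g k +
      (M%:R - 1) * \sum_k \sum_l p k * p l * h k l)).
    apply: eq_bigr => i _; under eq_bigr do rewrite mulrDr.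
    rewrite big_split expectation_codeword /=; congr (_ + _).
    under eq_bigr do rewrite mulr_sumr.
    rewrite exchange_big /=; under eq_bigr => j ji do
      rewrite expectation_codeword_pair 1?eq_sym //.
    (* The truncated predecessor is harmless: the position [i] witnesses [M > 0]. *)
    have -> : M%:R - 1 = M.-1%:R :> R.
      by rewrite -subn1 natrB // (leq_ltn_trans _ (ltn_ord i)).
    by rewrite mulr_natl (sumr_const (predC1 i)) cardC1 card_ord.
  by rewrite sumr_const card_ord mulr_natl.
- by exists f.
Qed.

End RandomChoice.

(** * Outcome probabilities, the square-root decoder and random coding *)

Section Codes.
Variable R : realType.
Local Notation C := (R[i]).

Lemma Re_toC_mul (x : R) (z : C) : complex.Re (toC x * z) = x * complex.Re z.
Proof. by case: z => a b /=; rewrite mul0r subr0. Qed.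

Lemma ReD (x y : C) : complex.Re (x + y) = complex.Re x + complex.Re y.
Proof. by case: x y => ? ? []. Qed.

Lemma Re_ge0 (z : C) : 0 <= z -> 0 <= complex.Re z.
Proof. by rewrite lecE => /andP[]. Qed.

Lemma toC_ge0 (x : R) : 0 <= x -> 0 <= toC x.
Proof. by move=> x0; rewrite lecE /= eqxx. Qed.

(** The Born rule; the real part brings the value into [R]. It is also applied to pairs without a
    state, as in [info_trace]. *)
Definition prob n (rho E : 'M[C]_n) : R := complex.Re (\tr (rho *m E)).

Lemma probDr n (rho A B : 'M[C]_n) : prob rho (A + B) = prob rho A + prob rho B.
Proof. by rewrite /prob mulmxDr mxtraceD ReD. Qed.

Lemma probZr n (rho : 'M[C]_n) x A : prob rho (toC x *: A) = x * prob rho A.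
Proof. by rewrite /prob -scalemxAr mxtraceZ Re_toC_mul. Qed.

Lemma probBr n (rho A B : 'M[C]_n) : prob rho (A - B) = prob rho A - prob rho B.
Proof.
rewrite probDr -scaleN1r (_ : -1 = toC (-1)) ?probZr ?mulN1r //.
by rewrite /toC -[RHS]/((-1)%:C)%C rmorphN1.
Qed.

Lemma probMnr n (rho : 'M[C]_n) k A : prob rho (k%:R *: A) = k%:R * prob rho A.
Proof.
rewrite (_ : k%:R = toC k%:R) ?probZr //.
by rewrite -[RHS]/((k%:R)%:C)%C rmorph_nat.
Qed.

Lemma prob0r n (rho : 'M[C]_n) : prob rho 0 = 0.
Proof. by rewrite /prob mulmx0 mxtrace0. Qed.

Lemma prob_sumr n (rho : 'M[C]_n) I (r : seq I) (P : pred I) F :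
  prob rho (\sum_(k <- r | P k) F k) = \sum_(k <- r | P k) prob rho (F k).
Proof. by apply: (big_morph (prob rho)); [exact: probDr|exact: prob0r]. Qed.

Lemma probC n (A B : 'M[C]_n) : prob A B = prob B A.
Proof. by rewrite /prob mxtrace_mulC. Qed.

Lemma prob_ge0 n (A B : 'M[C]_n) : psd A -> psd B -> 0 <= prob A B.
Proof. by move=> pA pB; apply: Re_ge0; exact: psd_trmul_ge0. Qed.

Lemma prob1 n (rho : 'M[C]_n) : is_state rho -> prob rho 1%:M = 1.
Proof. by move=> [_ tr1]; rewrite /prob mulmx1 tr1. Qed.

Lemma prob_le1 n (rho E : 'M[C]_n) :
  is_state rho -> psd (1%:M - E) -> prob rho E <= 1.
Proof.
by move=> srho pE; rewrite -subr_ge0 -(prob1 srho) -probBr prob_ge0 //; case: srho.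
Qed.

(** The square-root measurement [X *m S i *m X], with [X] from [hayashi_nagaoka] for [W] the sum of
    all tests. Pairing that operator inequality with [rho] gives the constants 2 and 4. *)
Lemma exists_decoder n M (S : 'I_M -> 'M[C]_n) :
  (forall i, psd (S i)) -> (forall i, psd (1%:M - S i)) ->
  exists E : 'I_M -> 'M[C]_n,
  [/\ forall i, psd (E i), psd (1%:M - \sum_i E i) &
      forall i rho, is_state rho -> 1 - prob rho (E i) <=
        2 * (1 - prob rho (S i)) + \sum_(j | j != i) 4 * prob rho (S j)].
Proof.
move=> pS pS1; have pW : psd (\sum_i S i) by apply: psd_sum => i _; exact: pS.
have [X [hX pX HN]] := hayashi_nagaoka pW.
have XE i : X *m S i *m X = adjmx X *m S i *m X by rewrite hX.
exists (fun i => X *m S i *m X); split=> [i||i rho srho].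
- by rewrite XE; apply: psd_congr; exact: pS.
- by rewrite -mulmx_suml -mulmx_sumr.
have WS : \sum_i S i - S i = \sum_(j | j != i) S j.
  by rewrite (bigD1 i) //= addrAC subrr add0r.
have := HN (S i) (pS i) (pS1 i); rewrite WS.
have pWS : psd (\sum_(j | j != i) S j) by apply: psd_sum => j _; exact: pS.
move=> /(_ pWS) /(prob_ge0 srho.1).
rewrite probBr probDr !probMnr !probBr prob_sumr prob1 // mulr_sumr subr_ge0.
by [].
Qed.

(** Codewords are drawn independently from [p], and the decoder is built from the tests attached to
    the drawn indices. Some codebook does no worse than the average. *)
Lemma exists_code m n (Phi : 'M[C]_m -> 'M[C]_n) N M (p : 'I_N -> R)
    (tau : 'I_N -> 'M[C]_m) (T : 'I_N -> 'M[C]_n) :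
  is_channel Phi -> (0 < M)%N -> (forall k, 0 <= p k) -> \sum_k p k = 1 ->
  (forall k, is_state (tau k)) -> (forall k, psd (T k)) ->
  (forall k, psd (1%:M - T k)) ->
  exists (rhos : 'I_M -> 'M[C]_m) (Es : 'I_M -> 'M[C]_n),
  is_code rhos Es /\ err_prob Phi rhos Es <=
    2 * (1 - \sum_k p k * prob (Phi (tau k)) (T k)) +
    4 * ((M%:R - 1) * \sum_k \sum_l p k * p l * prob (Phi (tau k)) (T l)).
Proof.
move=> chPhi M0 p0 p1 stau pT pT1.
have [f hf] := exists_codebook M p0 p1
  (fun k => 2 * (1 - prob (Phi (tau k)) (T k)))
  (fun k l => 4 * prob (Phi (tau k)) (T l)).
have [Es [pE pE1 hE]] := exists_decoder (fun i => pT (f i)) (fun i => pT1 (f i)).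
exists (tau \o f), Es; split; first by split=> // i; exact: stau.
rewrite /err_prob ler_pdivrMl ?ltr0n //.
have -> : 1 - \sum_k p k * prob (Phi (tau k)) (T k) =
    \sum_k p k * (1 - prob (Phi (tau k)) (T k)).
  by under [RHS]eq_bigr do rewrite mulrBr mulr1; rewrite sumrB p1.
move: hf; under [X in _ * (X + _)]eq_bigr do rewrite mulrCA.
under [X in _ * (_ + _ * X)]eq_bigr => k _ do
  (under eq_bigr => l _ do rewrite mulrCA; rewrite -mulr_sumr).
rewrite -!mulr_sumr [X in _ + X]mulrCA => hf; apply: le_trans hf.
by apply: ler_sum => i _; apply: hE; exact: is_channel_state (stau _).
Qed.

End Codes.

(** * One-shot direct and converse bounds for separable inputs *)

Section Ensembles.
Variable R : realType.
Local Notation C := (R[i]).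

Lemma toC_real (x : R) : toC x \is Num.real.
Proof. by rewrite complex_real. Qed.

(** [Pi_spec] at one index with a free factor [c]. At [c = expR (n%:R * g)] the two unfold to the
    same term, and likewise [info_trace] and the trace in [inf_spec_MI]. *)
Definition info_op a n (c : R) (rho : 'M[C]_(a * n)) :=
  rho - toC c *: (ptrY rho *t ptrX rho).

Definition info_trace a n (c : R) (rho : 'M[C]_(a * n)) :=
  prob (posproj (info_op c rho)) (info_op c rho).

Section Ensemble.
Variables (a n N : nat) (p : 'I_N -> R) (sig : 'I_N -> 'M[C]_a) (om : 'I_N -> 'M[C]_n).
Hypotheses (p0 : forall k, 0 <= p k) (p1 : \sum_k p k = 1).
Hypotheses (ssig : forall k, is_state (sig k)) (som : forall k, is_state (om k)).

Let rho := \sum_k toC (p k) *: (sig k *t om k).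

Lemma info_op_ensemble c : info_op c rho =
  \sum_k toC (p k) *: (sig k *t (om k - toC c *: \sum_l toC (p l) *: om l)).
Proof.
rewrite /info_op /rho ptrX_sum ptrY_sum.
have -> : \sum_k ptrY (toC (p k) *: (sig k *t om k)) = \sum_k toC (p k) *: sig k.
  by apply: eq_bigr => k _; rewrite ptrYZ ptrY_tens (som k).2 scale1r.
have -> : \sum_k ptrX (toC (p k) *: (sig k *t om k)) = \sum_k toC (p k) *: om k.
  by apply: eq_bigr => k _; rewrite ptrXZ ptrX_tens (ssig k).2 scale1r.
set ob := \sum_k toC (p k) *: om k; rewrite tensmx_suml scaler_sumr -sumrB.
apply: eq_bigr => k _.
by rewrite tensmxZl tensmxBr tensmxZr scalerBr !scalerA mulrC.
Qed.

Lemma info_op_herm c : adjmx (info_op c rho) = info_op c rho.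
Proof.
have prho : psd rho.
  apply: psd_sum => k _; apply: psdZ; first exact: toC_ge0.
  by apply: psd_tens; [exact: (ssig k).1|exact: (som k).1].
have -> : info_op c rho = rho + toC (- c) *: (ptrY rho *t ptrX rho).
  rewrite /info_op -scaleNr; congr (_ + _ *: _).
  by rewrite /toC -[RHS]/((- c)%:C)%C rmorphN.
have pX : psd (ptrX rho) by exact: psd_ptrX.
have pY : psd (ptrY rho).
  rewrite /rho ptrY_sum; apply: psd_sum => k _.
  rewrite ptrYZ ptrY_tens (som k).2 scale1r.
  by apply: psdZ; [exact: toC_ge0|exact: (ssig k).1].
rewrite adjmxD (psd_herm prho) adjmxZ adjmx_tens (psd_herm pX) (psd_herm pY).
by rewrite (CrealP (toC_real _)).
Qed.

Lemma prob_info_op c (T : 'M[C]_(a * n)) : prob T (info_op c rho) =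
  \sum_k p k * (prob T (sig k *t om k) - c * \sum_l p l * prob T (sig k *t om l)).
Proof.
rewrite info_op_ensemble prob_sumr; apply: eq_bigr => k _.
rewrite probZr tensmxBr probBr tensmxZr probZr tensmx_sumr prob_sumr.
congr (_ * (_ - _ * _)); apply: eq_bigr => l _.
by rewrite tensmxZr probZr.
Qed.

Lemma info_trace_max c (T : 'M[C]_(a * n)) : psd T -> psd (1%:M - T) ->
  prob T (info_op c rho) <= info_trace c rho.
Proof.
move=> pT pT1; have := posproj_max (info_op_herm c) pT pT1.
by rewrite lecE => /andP[].
Qed.

(** The spectral projection acts on both systems, whereas a decoder sees the output only.
    Compressing it by each [sig k] removes the auxiliary system and keeps every probability that
    enters the trace. *)
Lemma exists_tests c : exists T : 'I_N -> 'M[C]_n,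
  [/\ forall k, psd (T k), forall k, psd (1%:M - T k) &
      info_trace c rho = \sum_k p k * prob (om k) (T k) -
        c * \sum_k \sum_l p k * p l * prob (om k) (T l)].
Proof.
have /choice[T hT] k : exists T' : 'M[C]_n, [/\ psd T', psd (1%:M - T') &
    forall X, \tr (T' *m X) = \tr (posproj (info_op c rho) *m (sig k *t X))].
  apply: compressed_test (ssig k); first exact: psd_posproj.
  by apply: psd_1_sub_posproj; exact: info_op_herm.
exists T; split=> [k|k|]; [by case: (hT k)|by case: (hT k)|].
rewrite /info_trace prob_info_op.
have TE k l : prob (posproj (info_op c rho)) (sig k *t om l) = prob (om l) (T k).
  by rewrite [RHS]probC /prob; case: (hT k) => _ _ ->.
(* The sums are exchanged so that the outer index is that of the test. *)
rewrite [X in _ - _ * X]exchange_big mulr_sumr -sumrB; apply: eq_bigr => k _.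
rewrite TE mulrBr; congr (_ - _); rewrite mulrCA; congr (_ * _).
by rewrite mulr_sumr; apply: eq_bigr => l _; rewrite TE mulrA [p l * _]mulrC.
Qed.

Lemma info_trace_le1 c : 0 <= c -> info_trace c rho <= 1.
Proof.
move=> c0; have [T [pT pT1 ->]] := exists_tests c.
rewrite lerBlDr; apply: ler_wpDr.
  apply: mulr_ge0 => //; apply: sumr_ge0 => k _; apply: sumr_ge0 => l _.
  by rewrite !mulr_ge0 //; apply: prob_ge0 (pT l); exact: (som k).1.
rewrite -p1; apply: ler_sum => k _; rewrite ler_piMr //.
exact: prob_le1 (som k) (pT1 k).
Qed.

End Ensemble.

Lemma info_trace_separable_le1 a m n (Phi : 'M[C]_m -> 'M[C]_n) (c : R)
    (rho : 'M[C]_(a * m)) : is_channel Phi -> separable rho -> 0 <= c ->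
  info_trace c (id_tens Phi rho) <= 1.
Proof.
move=> chPhi [N [p [sig [tau [p0 p1 ssig stau ->]]]]] c0.
rewrite id_tens_sum; last by case: chPhi.
by apply: info_trace_le1 => // k; exact: is_channel_state.
Qed.

Lemma direct_coding a m n (Phi : 'M[C]_m -> 'M[C]_n) (c : R)
    (rho : 'M[C]_(a * m)) M :
  is_channel Phi -> separable rho -> (0 < M)%N -> M%:R - 1 <= c ->
  exists (rhos : 'I_M -> 'M[C]_m) (Es : 'I_M -> 'M[C]_n), is_code rhos Es /\
    err_prob Phi rhos Es <= 6 * (1 - info_trace c (id_tens Phi rho)).
Proof.
move=> chPhi [N [p [sig [tau [p0 p1 ssig stau ->]]]]] M0 Mc.
rewrite id_tens_sum; last by case: chPhi.
have som k : is_state (Phi (tau k)) by exact: is_channel_state.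
have [T [pT pT1 ->]] := exists_tests p0 ssig som c.
have [rhos [Es [cd err]]] := exists_code chPhi M0 p0 p1 stau pT pT1.
exists rhos, Es; split=> //; apply: le_trans err _.
set al := \sum_k p k * _; set be := \sum_k \sum_l _.
have al1 : al <= 1.
  rewrite -p1; apply: ler_sum => k _; rewrite ler_piMr //.
  exact: prob_le1 (som k) (pT1 k).
have be0 : 0 <= be.
  apply: sumr_ge0 => k _; apply: sumr_ge0 => l _.
  by rewrite !mulr_ge0 //; apply: prob_ge0 (pT l); exact: (som k).1.
have : (M%:R - 1) * be <= c * be by rewrite ler_wpM2r.
have : 0 <= (M%:R - 1) * be.
  by rewrite mulr_ge0 // subr_ge0 ler1n.
(* Since [info_trace] is [al - v], both [1 - al] and [v] are at most [1 - info_trace], and [u <= v];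
   hence the factor [6 = 2 + 4]. *)
move: ((M%:R - 1) * be) (c * be) => u v; lra.
Qed.

Lemma is_state_delta M (i : 'I_M) : is_state (delta_mx i i : 'M[C]_M).
Proof.
split.
  have h : adjmx (delta_mx i i) = delta_mx i i :> 'M[C]_M.
    by apply/matrixP => j k; rewrite adjmx_coef !mxE rmorph_nat andbC.
  by have := psd_gram (delta_mx i i : 'M[C]_M); rewrite h mul_delta_mx.
rewrite /mxtrace (bigD1 i) //= mxE eqxx big1 ?addr0 // => j /negPf ji.
by rewrite mxE ji.
Qed.

Lemma mul_delta_mx_diag M (i j : 'I_M) :
  delta_mx i i *m delta_mx j j = (i == j)%:R *: delta_mx i i :> 'M[C]_M.
Proof.
have [<-|ij] := eqVneq i j; first by rewrite mul_delta_mx scale1r.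
by rewrite mul_delta_mx_0 // scale0r.
Qed.

Lemma is_code_effect_le1 m n M (rhos : 'I_M -> 'M[C]_m) (Es : 'I_M -> 'M[C]_n) i :
  is_code rhos Es -> psd (1%:M - Es i).
Proof.
move=> [_ _ pE pE1].
have -> : 1%:M - Es i = (1%:M - \sum_i Es i) + \sum_(j | j != i) Es j.
  by rewrite [in RHS](bigD1 i) //= opprD addrA addrNK.
by apply: psdD pE1 _; apply: psd_sum => j _; exact: pE.
Qed.

(** The register of [rho] records the message, and the test [T] reads it and applies the matching
    effect. [T] succeeds with probability [1 - err_prob] on the joint state and at most [1 / M] on
    the product of the marginals. [rho] is chosen before [c], so one input serves all rates. *)
Lemma converse_coding m n (Phi : 'M[C]_m -> 'M[C]_n) M
    (rhos : 'I_M -> 'M[C]_m) (Es : 'I_M -> 'M[C]_n) :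
  is_channel Phi -> is_code rhos Es ->
  exists rho : 'M[C]_(M * m), separable rho /\
   forall c, 0 <= c ->
   1 - err_prob Phi rhos Es - c / M%:R <= info_trace c (id_tens Phi rho).
Proof.
move=> chPhi cd; have [M0 srhos pE pE1] := cd.
have pE1' i := is_code_effect_le1 i cd.
have MR : M%:R != 0 :> R by rewrite pnatr_eq0 -lt0n.
pose p (i : 'I_M) : R := M%:R^-1; pose sig (i : 'I_M) : 'M[C]_M := delta_mx i i.
have p0 i : 0 <= p i by rewrite invr_ge0.
have p1 : \sum_i p i = 1 by rewrite sumr_const card_ord -[LHS]mulr_natl mulfV.
have ssig i : is_state (sig i) by exact: is_state_delta.
exists (\sum_i toC (p i) *: (sig i *t rhos i)); split.
  by exists M, p, sig, rhos.
move=> c c0; rewrite id_tens_sum; last by case: chPhi.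
have som i : is_state (Phi (rhos i)) by exact: is_channel_state.
pose T := \sum_i sig i *t Es i.
have pT : psd T by apply: psd_sum => i _; apply: psd_tens (pE i); exact: (ssig i).1.
have pT1 : psd (1%:M - T).
  have -> : 1%:M - T = \sum_i sig i *t (1%:M - Es i).
    under eq_bigr do rewrite tensmxBr.
    rewrite sumrB -tensmx_suml; congr (_ - _); rewrite -tensmx1; congr (_ *t _).
    apply/matrixP => i j; rewrite summxE mxE (bigD1 i) //= mxE eqxx.
    rewrite big1 ?addr0 => [|k /negPf ki]; first by rewrite eq_sym.
    by rewrite mxE eq_sym ki.
  by apply: psd_sum => i _; apply: psd_tens (pE1' i); exact: (ssig i).1.
(* Orthogonality of the register states leaves only the [k]-th effect. *)
have TE k X : prob T (sig k *t X) = prob X (Es k).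
  rewrite probC /T prob_sumr (bigD1 k) //= big1 ?addr0 => [|i /negPf ik].
    by rewrite /prob tensmx_mul mxtrace_tens mul_delta_mx (ssig k).2 mul1r.
  rewrite /prob tensmx_mul mxtrace_tens mul_delta_mx_diag eq_sym ik scale0r.
  by rewrite mxtrace0 mul0r.
apply: le_trans (info_trace_max p0 ssig som c pT pT1).
rewrite prob_info_op //.
under eq_bigr => k _ do (rewrite TE; under eq_bigr => l _ do rewrite TE).
under eq_bigr => k _ do rewrite mulrBr.
rewrite sumrB; apply: lerB.
  rewrite /err_prob sumrB sumr_const card_ord mulrBr mulVf // opprB addrC subrK.
  by rewrite mulr_sumr.
(* Summing over the tested message first collects the effects into their sum, which is at most the
   identity; one factor [1 / M] remains. *)
have -> : \sum_i p i * (c * \sum_l p l * prob (Phi (rhos l)) (Es i)) =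
    c / M%:R * \sum_l p l * prob (Phi (rhos l)) (\sum_i Es i).
  under [X in _ = _ * X]eq_bigr do rewrite prob_sumr mulr_sumr.
  rewrite exchange_big mulr_sumr; apply: eq_bigr => i _.
  by rewrite mulrA [p i * c]mulrC.
rewrite ler_piMr ?divr_ge0 // -p1; apply: ler_sum => l _; rewrite ler_piMr //.
exact: prob_le1 (som l) pE1.
Qed.

End Ensembles.

(** * From one-shot bounds to asymptotic rates *)

Section Rates.
Variable R : realType.
Local Notation C := (R[i]).

(** The upper bound 1 turns the condition on the lower limit into plain convergence. *)
Lemma limn_einf_eq1P (t : nat -> R) : (forall n, t n <= 1) ->
  limn_einf (fun n => (t n)%:E) = 1%:E <-> t @ \oo --> (1 : R).
Proof.
move=> t1; split=> [tl|tl]; last first.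
  have /cvg_limn_einf_sup[] : (fun n => (t n)%:E) @ \oo --> 1%:E => //.
  by apply: cvg_EFin; [exact: nearW|exact: tl].
(* The negated sequence is bounded below by -1 and has upper limit -1, so it converges. *)
have h : (fun n => (- t n)%:E) @ \oo --> (-1)%:E.
  apply: limn_esup_le_cvg => [|n]; last by rewrite lee_fin lerN2.
  have -> : (fun n => (- t n)%:E) = (-%E \o (fun n => (t n)%:E)) by [].
  by rewrite limn_esupN tl.
have {}h : (fun n => - t n) @ \oo --> (-1 : R) by exact: fine_cvg h.
exact/cvgNP.
Qed.

Lemma err_prob_ge0 m n (Phi : 'M[C]_m -> 'M[C]_n) M
    (rhos : 'I_M -> 'M[C]_m) (Es : 'I_M -> 'M[C]_n) :
  is_channel Phi -> is_code rhos Es -> 0 <= err_prob Phi rhos Es.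
Proof.
move=> chPhi cd; have [M0 srhos _ _] := cd; rewrite /err_prob mulr_ge0 ?invr_ge0 //.
apply: sumr_ge0 => i _; rewrite subr_ge0.
exact: prob_le1 (is_channel_state chPhi (srhos i)) (is_code_effect_le1 i cd).
Qed.

Lemma spectral_rate_achievable (dK dH : nat -> nat)
    (Lam : forall n, 'M[C]_(dK n) -> 'M[C]_(dH n)) (dA : nat -> nat)
    (rho : forall n, 'M[C]_(dA n * dK n)) (g : R) :
  (forall n, is_channel (Lam n)) ->
  (forall n, separable (rho n)) ->
  limn_einf (fun n =>
    (info_trace (expR (n%:R * g)) (id_tens (Lam n) (rho n)))%:E) = 1%:E ->
  achievable Lam g.
Proof.
move=> chLam sep lim1; pose c n := expR (n%:R * g).
have c0 n : 0 <= c n by exact: expR_ge0.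
pose t n := info_trace (c n) (id_tens (Lam n) (rho n)).
have t1 n : t n <= 1 by exact: info_trace_separable_le1.
have tcvg : t @ \oo --> (1 : R) by exact/(limn_einf_eq1P t1).
(* This size satisfies both demands: [c n < M n] gives the rate and [M n - 1 <= c n] the error
   bound. *)
pose M n := (Num.truncn (c n)).+1.
have code n : exists RE : ('I_(M n) -> 'M[C]_(dK n)) * ('I_(M n) -> 'M[C]_(dH n)),
    is_code RE.1 RE.2 /\ err_prob (Lam n) RE.1 RE.2 <= 6 * (1 - t n).
  have Mc : (M n)%:R - 1 <= c n by rewrite /M -natr1 addrK truncn_le.
  have [//|rhos [Es cd]] := direct_coding (chLam n) (sep n) _ Mc.
  by exists (rhos, Es).
pose RE n := projT1 (cid (code n)).
have [cd err] : (forall n, is_code (RE n).1 (RE n).2) /\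
    forall n, err_prob (Lam n) (RE n).1 (RE n).2 <= 6 * (1 - t n).
  by split=> n; case: (projT2 (cid (code n))).
exists M, (fun n => (RE n).1), (fun n => (RE n).2); split=> //.
  by exists 0%N => n _; rewrite ltW // truncnS_gt.
apply: (@squeeze_cvgr _ _ _ _ (cst 0) (fun n => 6 * (1 - t n))).
- by near=> n; rewrite err andbT err_prob_ge0.
- exact: cvg_cst.
- rewrite (_ : 0 = 6 * (1 - 1) :> R); last by rewrite subrr mulr0.
  by apply: cvgM; [exact: cvg_cst|apply: cvgB => //; exact: cvg_cst].
Unshelve. all: by end_near.
Qed.

Lemma achievable_spectral_rate (dK dH : nat -> nat)
    (Lam : forall n, 'M[C]_(dK n) -> 'M[C]_(dH n)) (r : R) :
  (forall n, is_channel (Lam n)) -> achievable Lam r ->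
  exists (dA : nat -> nat) (rho : forall n, 'M[C]_(dA n * dK n)),
  [/\ forall n, (0 < dA n)%N, forall n, separable (rho n) &
      forall g, g < r -> limn_einf (fun n =>
        (info_trace (expR (n%:R * g)) (id_tens (Lam n) (rho n)))%:E) = 1%:E].
Proof.
move=> chLam [M [rhos [Es [cd [N Mr] err]]]].
pose rho n := projT1 (cid (converse_coding (chLam n) (cd n))).
have [sep conv] : (forall n, separable (rho n)) /\ forall n c, 0 <= c ->
    1 - err_prob (Lam n) (rhos n) (Es n) - c / (M n)%:R <=
    info_trace c (id_tens (Lam n) (rho n)).
  by split=> n; case: (projT2 (cid (converse_coding (chLam n) (cd n)))).
exists M, rho; split=> [n||g gr] //; first by case: (cd n).
pose c n := expR (n%:R * g).
have c0 n : 0 <= c n by exact: expR_ge0.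
apply/limn_einf_eq1P => [n|]; first exact: info_trace_separable_le1.
(* For [n >= N] the loss [c n / M n] is at most [expR (n (g - r))], a geometric sequence of ratio
   below 1 because [g < r]. *)
apply: (@squeeze_cvgr _ _ _ _
  (fun n => 1 - err_prob (Lam n) (rhos n) (Es n) - expR (g - r) ^+ n) (cst 1)).
- near=> n; apply/andP; split; last exact: info_trace_separable_le1.
  apply: le_trans (conv n _ (c0 n)); rewrite lerB // -expRM_natl mulrBr expRB.
  have Nn : (N <= n)%N by near: n; exists N.
  rewrite ler_wpM2l // lef_pV2 ?posrE ?expR_gt0 ?Mr //.
  by rewrite (lt_le_trans (expR_gt0 _) (Mr _ Nn)).
- rewrite -[X in _ --> X]subr0 -[X in _ --> X - _]subr0.
  apply: cvgB; last by apply: cvg_expr; rewrite ger0_norm ?expR_ge0 // expR_lt1 subr_lt0.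
  by apply: cvgB => //; exact: cvg_cst.
- exact: cvg_cst.
Unshelve. all: by end_near.
Qed.

End Rates.

(** * The capacity formula, by comparing the two suprema *)

Theorem theorem3 (R : realType) (dK dH : nat -> nat)
  (Lam : forall n, 'M[R[i]]_(dK n) -> 'M[R[i]]_(dH n)) :
  (forall n, (0 < dK n)%N) -> (forall n, (0 < dH n)%N) ->
  (forall n, is_channel (Lam n)) ->
  capacity Lam =
  ereal_sup [set x : \bar R | exists (dA : nat -> nat)
      (rho : forall n, 'M[R[i]]_(dA n * dK n)),
      [/\ forall n, (0 < dA n)%N, forall n, separable (rho n) &
          x = inf_spec_MI (fun n => id_tens (Lam n) (rho n))]].
Proof.
move=> _ _ chLam; apply/eqP; rewrite eq_le; apply/andP; split.
- apply: ge_ereal_sup => _ [r ar <-].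
  have [dA [rho [dA0 sep rate]]] := achievable_spectral_rate chLam ar.
  apply: (@le_trans _ _ (inf_spec_MI (fun n => id_tens (Lam n) (rho n)))).
    (* Only rates strictly below [r] are known to lie in the set, so the bound is proved up to an
       arbitrary [e > 0]. *)
    apply/lee_addgt0Pr => e e0; rewrite -leeBlDr // -EFinB.
    apply: ereal_sup_ubound; exists (r - e) => //=.
    by apply: rate; rewrite ltrBlDr ltrDl.
  by apply: ereal_sup_ubound; exists dA, rho.
- apply: ge_ereal_sup => _ [dA [rho [_ sep ->]]].
  (* Each [g] in the set defining the spectral rate is itself achievable, without loss. *)
  apply: ge_ereal_sup => _ [g /= lim1 <-].
  apply: ereal_sup_ubound; exists g => //.
  exact: spectral_rate_achievable chLam sep lim1.
Qed.
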